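(* There exist point sets $A,B\subset\mathbb{R}^d$ with $|A|=|B|=n$ and minimum matching cost $M$ between them such that, if they are randomly projected down to $m=o(\log n)$ dimensions using an appropriately scaled Gaussian random matrix, the cost of the optimal matching between the projected sets in $\mathbb{R}^m$ is $o(M)$ with probability at least $2/3$.
   Context: The matching cost of a perfect matching between two equal-size point sets is the sum of Euclidean distances of matched pairs; $M$ is the minimum over perfect matchings between $A$ and $B$. Asymptotic notation is as $n\to\infty$. *)

(* Defs.v *)
From HB Require Import structures.
From mathcomp Require Import all_boot all_order all_algebra all_fingroup.
From mathcomp Require Import all_classical all_reals all_analysis.

Set Implicit Arguments.
Unset Strict Implicit.
Unset Printing Implicit Defensive.

Import Order.TTheory GRing.Theory Num.Theory.
Import numFieldNormedType.Exports.

Local Open Scope classical_set_scope.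
Local Open Scope ring_scope.

(* Not `|v|: the canonical norm on matrices is the sup norm. *)
Definition norm2 (R : realType) (d : nat) (v : 'cV[R]_d) : R :=
  Num.sqrt (\sum_(i < d) v i ord0 ^+ 2).

(* A point set of size n is given by an enumeration 'I_n -> 'cV[R]_d, so that a
   perfect matching between two of them is a permutation of 'I_n. The
   enumeration need not be injective: images of point sets under a linear map
   are thus counted with multiplicity. *)
Definition matching_cost (R : realType) (d n : nat) (A B : 'I_n -> 'cV[R]_d)
    (s : 'S_n) : R :=
  \sum_(i < n) norm2 (A i - B (s i)).

(* The identity only serves as the starting value of the iterated minimum; it
   is itself one of the perfect matchings. *)
Definition min_matching_cost (R : realType) (d n : nat)
    (A B : 'I_n -> 'cV[R]_d) : R :=
  \big[Num.min/matching_cost A B 1%g]_(s : 'S_n) matching_cost A B s.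

Definition mutually_independent (R : realType) (dT : measure_display)
    (T : measurableType dT) (P : probability T R) (I : finType)
    (X : I -> {RV P >-> R}) : Prop :=
  forall (J : {set I}) (U : I -> set R),
    (forall i, i \in J -> measurable (U i)) ->
    P (\bigcap_(i in [set` J]) (X i @^-1` U i)) =
    (\prod_(i in J) P (X i @^-1` U i))%E.

(* Independent N(0, 1/m) entries (standard deviation 1 / sqrt m): the scaling
   for which the expected value of |G x|^2 is |x|^2. *)
Definition scaled_gaussian_matrix (R : realType) (dT : measure_display)
    (T : measurableType dT) (P : probability T R) (m d : nat)
    (G : 'I_m -> 'I_d -> {RV P >-> R}) : Prop :=
  mutually_independent (fun ij : 'I_m * 'I_d => G ij.1 ij.2) /\
  forall i j (U : set R), measurable U ->
    distribution P (G i j) U = normal_prob 0 (Num.sqrt m%:R)^-1 U.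

Definition project (R : realType) (dT : measure_display)
    (T : measurableType dT) (P : probability T R) (m d n : nat)
    (G : 'I_m -> 'I_d -> {RV P >-> R}) (A : 'I_n -> 'cV[R]_d) (w : T)
    : 'I_n -> 'cV[R]_m :=
  fun k => (\matrix_(i < m, j < d) G i j w) *m A k.

(* Main.v *)
(* Take the 2n standard basis vectors of R^(2n), n of them in A and n in B: any
   two are at distance sqrt 2, so M is of order n, and the projected points x_j
   are the independent columns of the Gaussian matrix. Cut R^m into K^m cells
   by cutting each axis, rescaled by sqrt m, into K intervals, of length 1/q
   except for the two unbounded ones. For K fixed and m = o(log n) there are
   far fewer cells than points.

   Match the points greedily inside the cells. Two points in the same cell are
   close up to a fourth-moment error, which accounts for the unbounded cells.
   The number of points left over is the sum over the cells of |a_c - b_c|,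
   where a_c and b_c are the numbers of points of the two sets in the cell c;
   since any two columns fall in the same cell with the same probability, the
   sum of (a_c - b_c)^2 has expectation at most 2n, so few points are left
   over.
   Altogether the expected cost is O(n / q) for n large, for every q, and
   Markov's inequality concludes. *)
Require Import Defs.
From HB Require Import structures.
From mathcomp Require Import all_boot all_order all_algebra all_fingroup.
From mathcomp Require Import all_classical all_reals all_analysis.
From mathcomp Require Import measurable_realfun ring lra.

Set Implicit Arguments.
Unset Strict Implicit.
Unset Printing Implicit Defensive.

Import Order.TTheory GRing.Theory Num.Theory.
Import numFieldNormedType.Exports.

Local Open Scope classical_set_scope.
Local Open Scope ring_scope.

(** * Deterministic bound on the matching cost *)

(** Take a permutation with the most agreements. No label is then left over on both sides, so the
    leftovers with label [c] are exactly the surplus of [c]. The factor 2 appears because a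
    disagreement is a leftover for each of its two labels. *)
Lemma exists_perm_few_disagreements (R : realDomainType) (I C : finType)
    (al be : I -> C) :
  exists s : {perm I}, 2 * \sum_i (al i != be (s i))%:R =
    \sum_c `|\sum_i (al i == c)%:R - \sum_i (be i == c)%:R| :> R.
Proof.
pose good (s : {perm I}) := [set i | al i == be (s i)]%SET.
have [s _ smax] := @arg_maxnP _ (1%g : {perm I}) predT (fun s => #|good s|) isT.
exists s.
(* If [i] and [j] are both unmatched but [al i] is the label of the partner of
   [j], exchanging the partners of [i] and [j] contradicts maximality. *)
have noswap i j : al i != be (s i) -> al j != be (s j) -> al i != be (s j).
  move=> bi bj; apply/negP => /eqP aij.
  have /= := smax (tperm i j * s)%g isT.
  rewrite leqNgt => /negP; apply; apply: proper_card; apply/properP; split.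
    apply/fintype.subsetP => x; rewrite !finset.inE permM => gx.
    case: tpermP => [xi|xj|//]; first by rewrite xi (negbTE bi) in gx.
    by rewrite xj (negbTE bj) in gx.
  by exists i; rewrite !finset.inE ?permM ?tpermL; first exact/eqP.
rewrite mulr_sumr.
transitivity (\sum_c \sum_(i | al i != be (s i))
    ((al i == c)%:R + (be (s i) == c)%:R : R)).
  rewrite exchange_big/= [LHS](bigID (fun i => al i != be (s i)))/=.
  rewrite [X in _ + X]big1 ?addr0; last first.
    by move=> i /negPn ->; rewrite mulr0.
  apply: eq_bigr => i ->; rewrite big_split/= mulr1.
  have sum1 d : \sum_c (d == c)%:R = 1 :> R.
    by rewrite (bigD1 d)//= eqxx big1 ?addr0// => c /negbTE; rewrite eq_sym => ->.
  by rewrite !sum1.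
apply: eq_bigr => c _.
rewrite [X in `|_ - X|](reindex_perm s)/= -sumrB.
rewrite [X in `|X|](bigID (fun i => al i != be (s i)))/=.
rewrite [X in `|_ + X|]big1 ?addr0; last first.
  by move=> i /negPn/eqP ->; rewrite subrr.
(* By [noswap], an unmatched [al i] equal to [c] excludes any unmatched [be (s j)] equal to [c]. In
   both cases one of the two families of indicators vanishes and the sign inside the absolute value
   is known. *)
have [/existsP[i /andP[bi /eqP aic]]|] :=
    boolP [exists i, (al i != be (s i)) && (al i == c)].
  rewrite ger0_norm; last first.
    apply: sumr_ge0 => j bj; have := noswap i j bi bj.
    by rewrite aic eq_sym => /negbTE ->; rewrite subr0.
  apply: eq_bigr => j bj; have := noswap i j bi bj.
  by rewrite aic eq_sym => /negbTE ->; rewrite subr0 addr0.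
move=> /existsPn noa.
have noa' i : al i != be (s i) -> (al i == c) = false.
  by move=> bi; have := noa i; rewrite bi /= => /negbTE.
rewrite ler0_norm -?sumrN; last first.
  by apply: sumr_le0 => i /noa' ->; rewrite sub0r oppr_le0.
by apply: eq_bigr => i /noa' ->; rewrite sub0r opprK add0r.
Qed.

(** For [i] up to [2 * q ^ 2] this is the grid of step [1/q] from [-q] to [q]. *)
Definition threshold {R : realType} (q i : nat) : R :=
  (i%:R - (q ^ 2)%:R) / q%:R.

(* An interval between consecutive thresholds is encoded by the thresholds below
   it, so that its measurability is immediate. *)
Definition bin {R : realType} (q : nat) (u : R) :
    {ffun 'I_(2 * q ^ 2).+1 -> bool} :=
  [ffun i : 'I_(2 * q ^ 2).+1 => threshold q i <= u].

(** Within [(-q, q)] points of one bin are at distance at most [1/q], which gives the term 1.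
    Otherwise the larger point [w] in absolute value satisfies [q <= |w|], and the fourth powers
    take over. *)
Lemma bin_eq_dist (R : realType) (q : nat) (u v : R) : (0 < q)%N ->
  bin q u = bin q v ->
  (u - v) ^+ 2 <= (1 + 4 * (u ^+ 4 + v ^+ 4)) / q%:R ^+ 2.
Proof.
move=> q0.
wlog uv : u v / u <= v => [hw|buv].
  have [|/ltW] := leP u v; first exact: hw.
  move=> vu /esym /(hw _ _ vu) h.
  by rewrite -[X in X <= _]sqrrN opprB [u ^+ 4 + _]addrC.
have q0' : 0 < q%:R :> R by rewrite ltr0n.
rewrite ler_pdivlMr ?exprn_gt0//.
have large w z : q%:R <= `|w| -> `|z| <= `|w| ->
    (w - z) ^+ 2 * q%:R ^+ 2 <= 4 * w ^+ 4 :> R.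
  move=> qw zw.
  have qw2 : q%:R ^+ 2 <= w ^+ 2.
    by rewrite -(real_normK (num_real w)) lerXn2r ?nnegrE// ltW.
  have zw2 : z ^+ 2 <= w ^+ 2.
    by rewrite -(real_normK (num_real w)) -(real_normK (num_real z)) lerXn2r ?nnegrE.
  have wz : (w - z) ^+ 2 <= 4 * w ^+ 2 by have := sqr_ge0 (w + z); lra.
  rewrite (_ : 4 * w ^+ 4 = (4 * w ^+ 2) * w ^+ 2); last by ring.
  by apply: ler_pM => //; rewrite sqr_ge0.
have u4 : 0 <= u ^+ 4 by rewrite exprn_even_ge0.
have v4 : 0 <= v ^+ 4 by rewrite exprn_even_ge0.
have [uq|uq] := leP q%:R `|u|; last first.
  have [vq|vq] := leP q%:R `|v|.
    have := large v u vq (ltW (lt_le_trans uq vq)).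
    by rewrite -[X in X * _]sqrrN opprB; lra.
  move: uq vq; rewrite !ltr_norml => /andP[u1 u2] /andP[v1 v2].
  (* The integer part of this product is the index of the last threshold at or below [v]. Equality
     of the bins puts [u] above that threshold too, hence within [1/q] of [v]. *)
  have vq0 : 0 <= (v + q%:R) * q%:R by rewrite mulr_ge0// ?ltW//; lra.
  have /andP[i1 i2] := truncn_itv vq0.
  set i := Num.truncn _ in i1 i2.
  have iN : (i < (2 * q ^ 2).+1)%N.
    rewrite ltnS -(ler_nat R) (le_trans i1)// natrM natrX expr2 mulrA.
    by rewrite ler_pM2r//; lra.
  move/ffunP/(_ (Ordinal iN)): buv; rewrite !ffunE/= /threshold.
  rewrite !ler_pdivrMr// natrX => tuv.
  have : i%:R - q%:R ^+ 2 <= u * q%:R.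
    by rewrite tuv; move: i1; rewrite mulrDl expr2; lra.
  move: i2; rewrite mulrDl -natr1 expr2 => i2 i3.
  have vu1 : (v - u) * q%:R <= 1 by rewrite mulrBl; lra.
  have vu0 : 0 <= (v - u) * q%:R by rewrite mulr_ge0// ?subr_ge0// ltW.
  have : ((v - u) * q%:R) ^+ 2 <= 1 by rewrite exprn_ile1.
  by rewrite exprMn -[X in X * _]sqrrN opprB; lra.
have [vu|vu] := leP `|v| `|u|; first by have := large u v uq vu; lra.
have := large v u (le_trans uq (ltW vu)) (ltW vu).
by rewrite -[X in X * _]sqrrN opprB; lra.
Qed.

(** This trades the square root for a sum over coordinates. The parameter [t] will be [1/q] for two
    points in one cell and [q] for points in different cells. *)
Lemma norm2_le_AMGM (R : realType) (d : nat) (v : 'cV[R]_d) (t : R) : 0 < t ->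
  norm2 v <= t + (\sum_(i < d) v i ord0 ^+ 2) / t.
Proof.
move=> t0; rewrite /norm2; set a := \sum_(i < d) _.
have a0 : 0 <= a by apply: sumr_ge0 => i _; exact: sqr_ge0.
rewrite -{2}(sqr_sqrtr a0); set r := Num.sqrt a.
have r0 : 0 <= r by exact: sqrtr_ge0.
have [rt|tr] := leP r t.
  by rewrite (le_trans rt)// lerDl divr_ge0// ?sqr_ge0// ltW.
by rewrite ler_wpDl// ?(ltW t0)// ler_pdivlMr// expr2 ler_wpM2l// ltW.
Qed.

Definition cell {R : realType} (q : nat) {m : nat} (x : 'cV[R]_m) :
    {ffun 'I_m -> {ffun 'I_(2 * q ^ 2).+1 -> bool}} :=
  [ffun k : 'I_m => bin q (Num.sqrt m%:R * x k ord0)].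

(** This is the average over the coordinates of the fourth power of [sqrt m * x k]. For a Gaussian
    column these are standard normal, so its expectation is bounded independently of [m]. *)
Definition quartic {R : realType} {m : nat} (x : 'cV[R]_m) : R :=
  m%:R * \sum_k x k ord0 ^+ 4.

Lemma quartic_ge0 (R : realType) (m : nat) (x : 'cV[R]_m) : 0 <= quartic x.
Proof. by rewrite mulr_ge0// sumr_ge0// => k _; rewrite exprn_even_ge0. Qed.

Lemma sum_sqr_sub_le (R : realType) (m : nat) (x y : 'cV[R]_m) :
  \sum_(k < m) (x - y) k ord0 ^+ 2 <= 4 + 2 * (quartic x + quartic y).
Proof.
case: m x y => [|m] x y.
  by rewrite big_ord0 addr_ge0// mulr_ge0// addr_ge0// quartic_ge0.
have m0 : 0 < m.+1%:R :> R by rewrite ltr0n.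
(* This is [t <= 1 + t ^ 2] for [t = m.+1 * z ^ 2]. The summands [1 / m.+1] add up to a constant
   over the coordinates. *)
have sqr_le (z : R) : z ^+ 2 <= m.+1%:R^-1 + m.+1%:R * z ^+ 4.
  rewrite -(ler_pM2l m0) mulrDr divff ?gt_eqF//.
  have -> : m.+1%:R * (m.+1%:R * z ^+ 4) = (m.+1%:R * z ^+ 2) ^+ 2 :> R by ring.
  by set t := _ * z ^+ 2; have := sqr_ge0 (t - 1); have := sqr_ge0 t; lra.
apply: (@le_trans _ _ (\sum_(k < m.+1) (4 * m.+1%:R^-1 +
    (2 * m.+1%:R * x k ord0 ^+ 4 + 2 * m.+1%:R * y k ord0 ^+ 4)))).
  apply: ler_sum => k _; rewrite !mxE.
  have hx := sqr_le (x k ord0); have hy := sqr_le (y k ord0).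
  have := sqr_ge0 (x k ord0 + y k ord0).
  rewrite -!(mulrA 2); move: hx hy.
  by move: (_ * x k ord0 ^+ 4) (_ * y k ord0 ^+ 4) m.+1%:R^-1 => X Y Z; lra.
rewrite !big_split/= sumr_const card_ord -!mulr_sumr /quartic.
by rewrite -[X in X + _]mulr_natr mulfVK ?gt_eqF//; lra.
Qed.

Lemma sum_sqr_sub_cell_le (R : realType) (q m : nat) (x y : 'cV[R]_m) :
  (0 < q)%N -> cell q x = cell q y ->
  \sum_(k < m) (x - y) k ord0 ^+ 2 <=
    (1 + 4 * (quartic x + quartic y)) / q%:R ^+ 2.
Proof.
move=> q0 cxy; have q20 : 0 < q%:R ^+ 2 :> R by rewrite exprn_gt0 ?ltr0n.
case: m x y cxy => [|m] x y cxy.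
  by rewrite big_ord0 divr_ge0 ?(ltW q20)// addr_ge0// mulr_ge0// addr_ge0// quartic_ge0.
have m0 : 0 < m.+1%:R :> R by rewrite ltr0n.
apply: (@le_trans _ _ (\sum_(k < m.+1) ((m.+1%:R^-1 +
    (4 * m.+1%:R * x k ord0 ^+ 4 + 4 * m.+1%:R * y k ord0 ^+ 4)) / q%:R ^+ 2))).
  apply: ler_sum => k _; rewrite !mxE.
  move/ffunP/(_ k): cxy; rewrite !ffunE => /(bin_eq_dist q0).
  set r := Num.sqrt _.
  have r2 : r ^+ 2 = m.+1%:R by rewrite sqr_sqrtr.
  have r4 : r ^+ 4 = m.+1%:R ^+ 2 by rewrite -r2 -exprM.
  rewrite !ler_pdivlMr// -mulrBr !exprMn r2 r4 => h; rewrite -(ler_pM2l m0).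
  rewrite mulrA (le_trans h)// [leRHS]mulrDr divff ?gt_eqF//.
  by rewrite le_eqVlt; apply/orP; left; apply/eqP; ring.
rewrite -mulr_suml ler_wpM2r ?invr_ge0 ?(ltW q20)//.
rewrite !big_split/= sumr_const card_ord -!mulr_sumr /quartic.
by rewrite -[X in X + _]mulr_natr mulVf ?gt_eqF//; lra.
Qed.

Lemma norm2_sub_le (R : realType) (q m : nat) (x y : 'cV[R]_m) : (0 < q)%N ->
  norm2 (x - y) <= q%:R * (cell q x != cell q y)%:R +
    4 * (1 + (quartic x + quartic y)) / q%:R.
Proof.
move=> q0; have q0' : 0 < q%:R :> R by rewrite ltr0n.
have := quartic_ge0 x; have := quartic_ge0 y => qy qx.
have [cxy|cxy] := eqVneq; rewrite /= ?mulr0 ?mulr1.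
  have iq0 : 0 < q%:R^-1 :> R by rewrite invr_gt0.
  apply: (le_trans (norm2_le_AMGM (x - y) iq0)).
  rewrite add0r invrK -(ler_pM2r q0') mulrDl mulVf ?gt_eqF// mulfVK ?gt_eqF//.
  have := sum_sqr_sub_cell_le q0 cxy.
  by rewrite ler_pdivlMr ?exprn_gt0// expr2 mulrA; lra.
apply: (le_trans (norm2_le_AMGM (x - y) q0')).
rewrite lerD2l ler_pM2r ?invr_gt0//.
by have := sum_sqr_sub_le x y; lra.
Qed.

(** Left indices stand for the points of one set, right indices for those of the other. Squares are
    used because their expectation can be read off from pairwise collisions. *)
Definition imbalance (R : realType) {C : finType} {n : nat}
    (f : 'I_(n + n) -> C) : R :=
  \sum_c (\sum_k (f (lshift n k) == c)%:R - \sum_k (f (rshift n k) == c)%:R) ^+ 2.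

(* The first two terms pay for the pairs of points in different cells, through
   [|z| <= z ^ 2 / q ^ 2 + q ^ 2] with [z] the surplus of each of the cells. *)
Definition cost_bound {R : realType} (q m n : nat) (x : 'I_(n + n) -> 'cV[R]_m) :
    R :=
  imbalance R (cell q \o x) / q%:R + q%:R ^+ 3 * ((2 ^ (2 * q ^ 2).+1) ^ m)%:R +
  4 * (n%:R + \sum_j quartic (x j)) / q%:R.

Lemma min_matching_cost_le (R : realType) (q m n : nat)
    (x : 'I_(n + n) -> 'cV[R]_m) : (0 < q)%N ->
  min_matching_cost (x \o lshift n) (x \o @rshift n n) <= cost_bound q x.
Proof.
move=> q0; have q0' : 0 < q%:R :> R by rewrite ltr0n.
have [s es] := exists_perm_few_disagreements R
  (cell q \o (x \o lshift n)) (cell q \o (x \o @rshift n n)).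
apply: (bigmin_inf s) => //.
pose a i := (q%:R * (cell q (x (lshift n i)) != cell q (x (rshift n (s i))))%:R +
  4 * (1 + (quartic (x (lshift n i)) + quartic (x (rshift n (s i))))) / q%:R : R).
apply: (@le_trans _ _ (\sum_i a i)).
  by apply: ler_sum => i _; exact: norm2_sub_le.
rewrite big_split/= -mulr_sumr /cost_bound; apply: lerD; last first.
  rewrite -mulr_suml ler_wpM2r ?invr_ge0 ?(ltW q0')// -mulr_sumr.
  rewrite !big_split/= sumr_const card_ord big_split_ord/=.
  by rewrite [X in _ <= _ * (_ + (_ + X))](reindex_perm s).
have {}es : 2 * \sum_i (cell q (x (lshift n i)) !=
    cell q (x (rshift n (s i))))%:R <=
    imbalance R (cell q \o x) / q%:R ^+ 2 +
    q%:R ^+ 2 * ((2 ^ (2 * q ^ 2).+1) ^ m)%:R :> R.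
  rewrite es.
  (* All boolean vectors are counted as bins, whether or not some real number realises them. It
     matters only that the base of the power depends on [q] alone. *)
  have -> : ((2 ^ (2 * q ^ 2).+1) ^ m)%N =
      #|{ffun 'I_m -> {ffun 'I_(2 * q ^ 2).+1 -> bool}}|.
    by rewrite !card_ffun card_bool !card_ord.
  rewrite mulr_natr -sumr_const /imbalance mulr_suml -big_split/=.
  apply: ler_sum => c _; set z := _ - _.
  rewrite -(real_normK (num_real z)).
  have [zq|qz] := leP `|z| (q%:R ^+ 2).
    by rewrite ler_wpDl// divr_ge0// exprn_ge0// ltW.
  rewrite ler_wpDr ?exprn_ge0 ?(ltW q0')// ler_pdivlMr ?exprn_gt0//.
  by rewrite expr2 ler_wpM2l// ltW.
have I0 : 0 <= imbalance R (cell q \o x) / q%:R.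
  by rewrite divr_ge0 ?(ltW q0')// sumr_ge0// => c _; rewrite sqr_ge0.
have K0 : 0 <= q%:R ^+ 3 * ((2 ^ (2 * q ^ 2).+1) ^ m)%:R :> R.
  by rewrite mulr_ge0 ?exprn_ge0// ltW.
have := ler_wpM2l (ltW q0') es; rewrite [X in _ <= X -> _]mulrDr.
have -> : q%:R * (imbalance R (cell q \o x) / q%:R ^+ 2) =
    imbalance R (cell q \o x) / q%:R.
  by field; rewrite gt_eqF.
have -> : q%:R * (q%:R ^+ 2 * ((2 ^ (2 * q ^ 2).+1) ^ m)%:R) =
    q%:R ^+ 3 * ((2 ^ (2 * q ^ 2).+1) ^ m)%:R :> R by ring.
by lra.
Qed.

(** * Gaussian moments and collisions of cells *)

(** The Radon-Nikodym derivative of the normal law and [normal_pdf] have the same integral on every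
    measurable set, so they agree almost everywhere. *)
Lemma ge0_integral_normal_prob (R : realType) (s : R) (f : R -> \bar R) :
  measurable_fun [set: R] f -> (forall x, 0 <= f x)%E ->
  (\int[normal_prob 0 s]_x f x =
   \int[lebesgue_measure]_x (f x * (normal_pdf 0 s x)%:E))%E.
Proof.
move=> mf f0.
have dom := normal_prob_dominates (0 : R) s.
rewrite -(Radon_Nikodym_SigmaFinite.change_of_variables dom)//.
have mpdf : measurable_fun [set: R] (fun x => (normal_pdf 0 s x)%:E).
  by apply/measurable_EFinP; exact: measurable_normal_pdf.
apply: ae_eq_integral => //.
- apply: emeasurable_funM => //.
  exact: measurable_int (Radon_Nikodym_SigmaFinite.f_integrable dom).
- exact: emeasurable_funM.
- apply: ae_eqe_mul2l; apply: integral_ae_eq => //.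
    exact: Radon_Nikodym_SigmaFinite.f_integrable.
  by move=> E _ mE; rewrite -Radon_Nikodym_SigmaFinite.f_integral.
Qed.

(* The density at scale [s] times [x ^ 4] is dominated by [32 s ^ 4] times the
   density at scale [2 s], whose integral is [1]. *)
Lemma normal_prob_fourth_moment_le (R : realType) (s : R) : 0 < s ->
  (\int[normal_prob 0 s]_x (x ^+ 4)%:E <= (32 * s ^+ 4)%:E)%E.
Proof.
move=> s0; have s1 : s != 0 by rewrite gt_eqF.
have s20 : 0 < 2 * s by rewrite mulr_gt0.
have mpdf t : measurable_fun [set: R] (fun x => (normal_pdf 0 t x)%:E).
  by apply/measurable_EFinP; exact: measurable_normal_pdf.
have c0 : 0 <= 32 * s ^+ 4 by rewrite mulr_ge0// exprn_ge0// ltW.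
have mx4 : measurable_fun [set: R] (fun x : R => (x ^+ 4)%:E).
  by apply/measurable_EFinP; exact: exprn_measurable.
rewrite ge0_integral_normal_prob//; last first.
  by move=> x; rewrite lee_fin exprn_even_ge0.
rewrite -[leRHS]mule1 -(integral_normal_pdf 0 (2 * s)) -ge0_integralZl//; last 2 first.
- exact: mpdf.
- by move=> x _; rewrite lee_fin normal_pdf_ge0.
apply: ge0_le_integral => //.
- by move=> x _; rewrite -EFinM lee_fin mulr_ge0 ?exprn_even_ge0 ?normal_pdf_ge0.
- by apply: emeasurable_funM; [exact: mx4|exact: mpdf].
- by apply: measurable_funeM; exact: mpdf.
move=> x _; rewrite -!EFinM lee_fin !normal_pdfE ?gt_eqF//=.
rewrite /normal_fun subr0.
have -> : normal_peak (2 * s) = normal_peak s / 2.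
  rewrite /normal_peak.
  have -> : (2 * s) ^+ 2 * pi *+ 2 = 2 ^+ 2 * (s ^+ 2 * pi *+ 2) :> R by ring.
  by rewrite sqrtrM// sqrtr_sqr ger0_norm// invfM mulrC.
(* In terms of [z] the two exponents are [-z] and [-4z]. The comparison reduces to
   [4 * z ^ 2 <= expR (3 * z)], which the quadratic term of the exponential provides. *)
set z := x ^+ 2 / (8 * s ^+ 2).
have z0 : 0 <= z by rewrite divr_ge0 ?sqr_ge0// mulr_ge0// sqr_ge0.
have -> : - x ^+ 2 / ((2 * s) ^+ 2 *+ 2) = - z by rewrite /z; field.
have -> : - x ^+ 2 / (s ^+ 2 *+ 2) = - z - 3 * z by rewrite /z; field.
have -> : x ^+ 4 = 64 * s ^+ 4 * z ^+ 2 by rewrite /z; field.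
rewrite expRD [expR (- (3 * z))]expRN.
have e3 : 0 < expR (3 * z) by exact: expR_gt0.
have p0 := normal_peak_ge0 s.
have e0 := expR_ge0 (- z).
have h : 4 * z ^+ 2 / expR (3 * z) <= 1.
  rewrite ler_pdivrMr// mul1r.
  have := @expR_ge1Dxn R (3 * z) 1 (mulr_ge0 (ler0n _ 3) z0).
  by rewrite (_ : 2`!%:R = 2 :> R)// exprMn; have := sqr_ge0 z; lra.
have := ler_wpM2l (mulr_ge0 (mulr_ge0 (exprn_ge0 4 (ltW s0)) p0) e0) h.
by rewrite mulr1; lra.
Qed.

Lemma measurable_fun_natr (d : measure_display) (T : measurableType d)
    (R : realType) (b : T -> bool) :
  measurable [set w | b w] -> measurable_fun [set: T] (fun w => (b w)%:R : R).
Proof.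
move=> mb; rewrite (_ : (fun w => _) = \1_[set w | b w]).
  exact: measurable_indic.
by apply/funext => w; rewrite indicE; congr (nat_of_bool _)%:R; apply/idP/idP;
  rewrite inE.
Qed.

Lemma integral_natr (d : measure_display) (T : measurableType d) (R : realType)
    (P : probability T R) (b : T -> bool) : measurable [set w | b w] ->
  (\int[P]_w (b w)%:R%:E = P [set w | b w])%E.
Proof.
move=> mb; rewrite -[X in P X]setIT -integral_indic//.
apply: eq_integral => w _; rewrite indicE; congr (nat_of_bool _)%:R%:E.
by apply/idP/idP; rewrite inE.
Qed.

(** Expand the squares: a product of two class sizes, summed over the classes, counts the pairs with
    equal labels. The cross term stays on the left so that only nonnegative functions have to be
    integrated. *)
Lemma imbalance_identity (R : realType) (C : finType) (n : nat)
    (f : 'I_(n + n) -> C) :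
  imbalance R f +
    2 * \sum_k \sum_k' (f (lshift n k) == f (rshift n k'))%:R =
  \sum_k \sum_k' (f (lshift n k) == f (lshift n k'))%:R +
    \sum_k \sum_k' (f (rshift n k) == f (rshift n k'))%:R.
Proof.
have crossE (a b : 'I_n -> C) : \sum_k \sum_k' (a k == b k')%:R =
    \sum_c (\sum_k (a k == c)%:R) * (\sum_k (b k == c)%:R) :> R.
  under [RHS]eq_bigr do rewrite mulr_suml.
  rewrite [RHS]exchange_big/=; apply: eq_bigr => k _.
  rewrite [RHS](bigD1 (a k))//= eqxx mul1r [X in _ = _ + X]big1 ?addr0.
    by apply: eq_bigr => k' _; rewrite eq_sym.
  by move=> c /negbTE; rewrite eq_sym => ->; rewrite mul0r.
rewrite !(crossE (f \o _) (f \o _)) /imbalance mulr_sumr -!big_split/=.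
by apply: eq_bigr => c _; ring.
Qed.

Section random_labels.
Context (d : measure_display) (T : measurableType d) (R : realType).
Context (P : probability T R) (C : finType) (n : nat).
Variables (f : 'I_(n + n) -> T -> C) (rho : R).
Hypothesis rho0 : 0 <= rho.
Hypothesis mf : forall j c, measurable [set w | f j w = c].
Hypothesis f_coll : forall j j', j != j' ->
  P [set w | f j w = f j' w] = rho%:E.

Lemma measurable_label_eq j j' : measurable [set w | f j w == f j' w].
Proof.
rewrite (_ : [set w | _] = \bigcup_(c in [set: C])
    ([set w | f j w = c] `&` [set w | f j' w = c])).
  by apply: fin_bigcup_measurable => // c _; exact: measurableI.
apply/seteqP; split => w /= => [/eqP fw|[c _ [-> ->]]//].
by exists (f j' w).
Qed.

Lemma measurable_imbalance :
  measurable_fun [set: T] (fun w => imbalance R (f ^~ w)).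
Proof.
have mc j c : measurable_fun [set: T] (fun w => (f j w == c)%:R : R).
  apply: measurable_fun_natr; rewrite (_ : [set w | _] = [set w | f j w = c])//.
  by apply/seteqP; split => w /= /eqP.
apply: measurable_sum => c; apply: measurable_funX.
by apply: measurable_funB; apply: measurable_sum => k.
Qed.

Let coll (a b : 'I_n -> 'I_(n + n)) w : R :=
  \sum_k \sum_k' (f (a k) w == f (b k') w)%:R.

Let coll_ge0 a b w : 0 <= coll a b w.
Proof. by do 2 apply: sumr_ge0 => ? _. Qed.

Let measurable_coll a b : measurable_fun [set: T] (coll a b).
Proof.
apply: measurable_sum => k; apply: measurable_sum => k'.
exact/measurable_fun_natr/measurable_label_eq.
Qed.

Let integral_coll a b :
  (\int[P]_w (coll a b w)%:E =
   \sum_k \sum_k' P [set w | f (a k) w = f (b k') w])%E.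
Proof.
have mab k k' : measurable_fun [set: T]
    (fun w => (f (a k) w == f (b k') w)%:R%:E : \bar R).
  exact/measurable_EFinP/measurable_fun_natr/measurable_label_eq.
under eq_integral do rewrite /coll -sumEFin.
rewrite ge0_integral_sum//; last 2 first.
- move=> k; apply/measurable_EFinP; apply: measurable_sum => k'.
  exact/measurable_fun_natr/measurable_label_eq.
- by move=> k w _; rewrite lee_fin sumr_ge0.
apply: eq_bigr => k _.
under eq_integral do rewrite -sumEFin.
rewrite ge0_integral_sum//; apply: eq_bigr => k' _.
rewrite integral_natr; last exact: measurable_label_eq.
by congr (P _); apply/seteqP; split => w /= /eqP.
Qed.

Let integral_coll_same a : injective a ->
  (\int[P]_w (coll a a w)%:E <= (n%:R + n%:R ^+ 2 * rho)%:E)%E.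
Proof.
move=> a_inj; rewrite integral_coll.
(* The diagonal pairs, which always collide, are charged [1 + rho] instead of 1, so that [rho] is
   summed over all [n ^ 2] pairs. *)
apply: (@le_trans _ _ (\sum_(k < n) \sum_(k' < n) ((k == k')%:R + rho)%:E)%E).
  apply: lee_sum => k _; apply: lee_sum => k' _.
  have [->|kk'] := eqVneq k k'; last by rewrite f_coll ?inj_eq// add0r.
  rewrite (_ : [set w | _] = setT) ?probability_setT ?lee_fin ?lerDl//.
  by apply/seteqP; split.
under eq_bigr do rewrite sumEFin.
rewrite sumEFin lee_fin; under eq_bigr do rewrite big_split/=.
rewrite big_split/=; under eq_bigr => k _.
  rewrite (bigD1 k)//= eqxx big1 ?addr0; last first.
    by move=> k' /negbTE; rewrite eq_sym => ->.
  over.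
by rewrite !sumr_const !card_ord -mulrnA -[X in _ + X <= _]mulr_natl natrM expr2.
Qed.

(** The cross collisions, [2 * n ^ 2 * rho] in expectation, cancel the off-diagonal collisions
    inside the two sets. What remains is the two diagonals, [n] each. *)
Lemma integral_imbalance_le :
  (\int[P]_w (imbalance R (f ^~ w))%:E <= (2 * n%:R)%:E)%E.
Proof.
have crossE : (\int[P]_w (2 * coll (lshift n) (@rshift n n) w)%:E =
    (2 * (n%:R ^+ 2 * rho))%:E)%E.
  under eq_integral do rewrite EFinM.
  rewrite ge0_integralZl//; last 2 first.
  - exact/measurable_EFinP/measurable_coll.
  - by move=> w _; rewrite lee_fin coll_ge0.
  rewrite integral_coll [RHS]EFinM; congr (_ * _)%E.
  under eq_bigr do under eq_bigr do rewrite f_coll ?lrshift_neq// ?eq_lrshift//.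
  under eq_bigr do rewrite sumEFin.
  rewrite sumEFin; congr EFin.
  by rewrite !sumr_const !card_ord -mulrnA -[LHS]mulr_natl natrM expr2.
rewrite -(@leeD2rE _ (2 * (n%:R ^+ 2 * rho))%:E)//.
rewrite -[in leLHS]crossE -ge0_integralD//=; last 4 first.
- by move=> w _; rewrite lee_fin sumr_ge0// => c _; rewrite sqr_ge0.
- exact/measurable_EFinP/measurable_imbalance.
- by move=> w _; rewrite lee_fin mulr_ge0// coll_ge0.
- by apply/measurable_EFinP/measurable_funM => //; exact: measurable_coll.
under eq_integral do rewrite -EFinD imbalance_identity EFinD.
rewrite ge0_integralD//=; last 4 first.
- by move=> w _; rewrite lee_fin (coll_ge0 (lshift n) (lshift n)).
- exact/measurable_EFinP/(measurable_coll (lshift n) (lshift n)).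
- by move=> w _; rewrite lee_fin (coll_ge0 (@rshift n n) (@rshift n n)).
- exact/measurable_EFinP/(measurable_coll (@rshift n n) (@rshift n n)).
apply: (le_trans (leeD (integral_coll_same (@lshift_inj n n))
  (integral_coll_same (@rshift_inj n n)))).
by rewrite -!EFinD lee_fin; lra.
Qed.

End random_labels.

Lemma measurable_bin (R : realType) (q : nat) (a : R) b :
  measurable [set x : R | bin q (a * x) = b].
Proof.
rewrite (_ : [set x | _] = \bigcap_(i in [set: 'I_(2 * q ^ 2).+1])
    [set x : R | (threshold q i <= a * x) = b i]).
  apply: fin_bigcap_measurable => // i _.
  have mi : measurable_fun [set: R] (fun x : R => threshold q i <= a * x).
    by apply: measurable_fun_ler => //; exact: measurable_funM.
  have := mi measurableT [set b i] I; rewrite setTI.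
  exact.
apply/seteqP; split => x /= => [<- i _|bx]; first by rewrite /= ffunE.
by apply/ffunP => i; rewrite ffunE bx.
Qed.

Section gaussian_columns.
Context (R : realType) (dT : measure_display) (T : measurableType dT).
Context (P : probability T R) (m d q : nat).
Variable G : 'I_m -> 'I_d -> {RV P >-> R}.
Hypothesis gaussG : scaled_gaussian_matrix G.

Definition column (w : T) (j : 'I_d) : 'cV[R]_m := \col_i G i j w.

Let pbin (b : {ffun 'I_(2 * q ^ 2).+1 -> bool}) : R :=
  fine (normal_prob (0 : R) (Num.sqrt m%:R)^-1
    [set x | bin q (Num.sqrt m%:R * x) = b]).

Let pcell (c : {ffun 'I_m -> {ffun 'I_(2 * q ^ 2).+1 -> bool}}) : R :=
  \prod_k pbin (c k).

(** The right-hand side has the form to which independence of the entries applies. Singletons [S]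
    will give measurability, and pairs the collision probability. *)
Let column_cellE c (S : {set 'I_d}) :
  [set w | forall j, j \in S -> cell q (column w j) = c] =
  \bigcap_(ij in [set` [set ij : 'I_m * 'I_d | ij.2 \in S]%SET])
    (G ij.1 ij.2 @^-1` [set x | bin q (Num.sqrt m%:R * x) = c ij.1]).
Proof.
apply/seteqP; split => w /=.
  move=> cw [i j] /=; rewrite finset.inE/= => /cw /ffunP/(_ i).
  by rewrite ffunE mxE.
move=> cw j jS; apply/ffunP => i; rewrite ffunE mxE.
by apply: (cw (i, j)); rewrite /= finset.inE.
Qed.

Let column_cell_prob c (S : {set 'I_d}) :
  P [set w | forall j, j \in S -> cell q (column w j) = c] =
  (\prod_(j in S) pcell c)%:E.
Proof.
have [indepG lawG] := gaussG.
rewrite column_cellE.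
rewrite (indepG _ (fun ij => [set x | bin q (Num.sqrt m%:R * x) = c ij.1])); last first.
  by move=> ij _; exact: measurable_bin.
transitivity (\prod_(ij : 'I_m * 'I_d | ij.2 \in S) (pbin (c ij.1))%:E)%E.
  apply: eq_big => [ij|ij _]; first by rewrite finset.inE.
  have mb := measurable_bin (Num.sqrt (m%:R : R)) (c ij.1).
  by rewrite -[LHS]/(distribution P _ _) lawG// fineK// fin_num_measure.
rewrite -(big_morph EFin (@EFinM R) erefl) /pcell exchange_big/=.
by rewrite (pair_big_dep xpredT (fun _ j => j \in S) (fun i _ => pbin (c i))).
Qed.

Lemma measurable_column_cell j c :
  measurable [set w | cell q (column w j) = c].
Proof.
rewrite (_ : [set w | _] =
    [set w | forall j', j' \in [set j]%SET -> cell q (column w j') = c]).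
  rewrite column_cellE; apply: fin_bigcap_measurable => // ij _.
  by rewrite -[X in measurable X]setTI; apply: measurable_funP => //; exact: measurable_bin.
apply/seteqP; split => w /=.
  by move=> cw j'; rewrite finset.inE => /eqP ->.
by apply; rewrite finset.inE.
Qed.

(** Any two columns are independent with the same law [pcell] on cells, so they meet in [c] with
    probability [pcell c ^ 2], whatever the pair. *)
Lemma column_cell_collision : exists rho : R, 0 <= rho /\
  forall j j', j != j' ->
    P [set w | cell q (column w j) = cell q (column w j')] = rho%:E.
Proof.
exists (\sum_c pcell c ^+ 2); split; first by apply: sumr_ge0 => c _; rewrite sqr_ge0.
move=> j j' jj'.
pose F c := [set w | forall k, k \in [set j; j']%SET -> cell q (column w k) = c].
have FP c w : F c w <-> cell q (column w j) = c /\ cell q (column w j') = c.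
  split=> [Fw|[cj cj'] k]; last by rewrite finset.in_set2 => /orP[] /eqP ->.
  by split; apply: Fw; rewrite finset.in_set2 eqxx ?orbT.
rewrite (_ : [set w | _] = \bigcup_(c in [set` predT]) F c); last first.
  apply/seteqP; split => w /= => [cw|[c _ /FP[-> ->]]//].
  by exists (cell q (column w j)) => //; apply/FP.
rewrite measure_fin_bigcup//.
- rewrite -(bigfs _ (index_enum_uniq _)); last by move=> c _; rewrite mem_index_enum.
  rewrite -sumEFin; apply: eq_bigr => c _.
  by rewrite [LHS](column_cell_prob c [set j; j']%SET) big_setU1 ?finset.in_set1//= big_set1.
- by move=> c c' _ _ [w [/FP[<- _] /FP[<- _]]].
- move=> c _; rewrite (_ : F c = [set w | cell q (column w j) = c] `&`
    [set w | cell q (column w j') = c]).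
    by apply: measurableI; exact: measurable_column_cell.
  by apply/seteqP; split => w /FP.
Qed.

End gaussian_columns.

(** * Cost of the projected matching *)

Lemma measurable_fun_norm2 (dT : measure_display) (T : measurableType dT)
    (R : realType) (d : nat) (v : T -> 'cV[R]_d) :
  (forall i, measurable_fun [set: T] (fun w => v w i ord0)) ->
  measurable_fun [set: T] (fun w => norm2 (v w)).
Proof.
move=> mv; rewrite /norm2.
apply: (@measurableT_comp _ _ _ _ _ _ (@Num.sqrt R)).
  by apply: continuous_measurable_fun => x; exact: sqrt_continuous.
by apply: measurable_sum => i; exact: measurable_funX.
Qed.

Lemma measurable_fun_min_matching_cost (dT : measure_display)
    (T : measurableType dT) (R : realType) (d n : nat)
    (A B : T -> 'I_n -> 'cV[R]_d) :
  (forall k i, measurable_fun [set: T] (fun w => A w k i ord0)) ->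
  (forall k i, measurable_fun [set: T] (fun w => B w k i ord0)) ->
  measurable_fun [set: T] (fun w => min_matching_cost (A w) (B w)).
Proof.
move=> mA mB.
have mcost s : measurable_fun [set: T] (fun w => matching_cost (A w) (B w) s).
  apply: measurable_sum => k; apply: measurable_fun_norm2 => i.
  by under eq_fun do rewrite !mxE; exact: measurable_funB.
rewrite /min_matching_cost; elim: (index_enum _) => [|s r ih].
  by under eq_fun do rewrite big_nil; exact: mcost.
by under eq_fun do rewrite big_cons; exact: measurable_minr.
Qed.

Lemma measurable_sublevel (dT : measure_display) (T : measurableType dT)
    (R : realType) (X : T -> R) (t : R) :
  measurable_fun [set: T] X -> measurable [set w | X w <= t].
Proof.
move=> mX; have := @measurable_fun_ler _ _ _ _ _ _ mX (measurable_cst t)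
  measurableT [set true] I.
by rewrite setTI.
Qed.

Lemma measurable_projected_cost_sublevel (R : realType) (dT : measure_display)
    (T : measurableType dT) (P : probability T R) (m d n : nat)
    (G : 'I_m -> 'I_d -> {RV P >-> R}) (A B : 'I_n -> 'cV[R]_d) (t : R) :
  measurable [set w |
    min_matching_cost (project G A w) (project G B w) <= t].
Proof.
have mproj (C : 'I_n -> 'cV[R]_d) k i :
    measurable_fun [set: T] (fun w => project G C w k i ord0).
  under eq_fun do rewrite mxE.
  apply: measurable_sum => j; apply: measurable_funM => //.
  by under eq_fun do rewrite mxE; exact: measurable_funPT.
exact/measurable_sublevel/measurable_fun_min_matching_cost.
Qed.

Lemma markov_two_thirds (dT : measure_display) (T : measurableType dT)
    (R : realType) (P : probability T R) (X : T -> R) (e t : R) :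
  measurable_fun [set: T] X -> (forall w, 0 <= X w) ->
  (\int[P]_w (X w)%:E <= e%:E)%E -> 0 < t -> 3 * e <= t ->
  ((2 / 3)%:E <= P [set w | (X w <= t)%R])%E.
Proof.
move=> mX X0 Xe t0 et.
have mle : measurable [set w | X w <= t] by exact: measurable_sublevel.
have mge : measurable [set w | t <= X w].
  have := @measurable_fun_ler _ _ _ _ _ _ (measurable_cst t) mX measurableT [set true] I.
  by rewrite setTI.
have := le_integral_abse P measurableT ((measurable_EFinP _ _).2 mX) t0.
rewrite setTI (_ : [set w | _] = [set w | t <= X w]); last first.
  by apply/seteqP; split => w /=; rewrite ger0_norm// lee_fin.
under eq_integral do rewrite /= ger0_norm//.
move=> /le_trans/(_ Xe) tP.
have Pge : (P [set w | (t <= X w)%R] <= (1 / 3)%:E)%E.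
  rewrite -(@lee_pmul2l _ t%:E)// ?lte_fin//; apply: (le_trans tP).
  by rewrite -EFinM lee_fin; lra.
have := probability_setC P mle.
have Pfin : P [set w | (X w <= t)%R] \is a fin_num by rewrite fin_num_measure.
have Plt : (P (~` [set w | (X w <= t)%R]) <= (1 / 3)%:E)%E.
  apply: le_trans Pge; apply: le_measure; rewrite ?inE//; first exact: measurableC.
  by move=> w /= /negP; rewrite -ltNge => /ltW.
move=> PC; move: Plt; rewrite PC -(fineK Pfin) -EFinB !lee_fin; lra.
Qed.

Section projected_cost.
Context (R : realType) (dT : measure_display) (T : measurableType dT).
Context (P : probability T R) (m n q : nat).
Variable G : 'I_m -> 'I_(n + n) -> {RV P >-> R}.
Hypothesis gaussG : scaled_gaussian_matrix G.
Hypothesis q_gt0 : (0 < q)%N.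

Let measurable_fun_quartic j :
  measurable_fun [set: T] (fun w => quartic (column G w j)).
Proof.
rewrite /quartic; apply: measurable_funM => //; apply: measurable_sum => k.
by under eq_fun do rewrite mxE; exact: measurable_funX.
Qed.

Lemma integral_quartic_le j :
  (\int[P]_w (quartic (column G w j))%:E <= 32%:E)%E.
Proof.
have [_ lawG] := gaussG.
have m4 k : measurable_fun [set: T] (fun w => (G k j w ^+ 4)%:E).
  by apply/measurable_EFinP; exact: measurable_funX.
have p4 k w : (0 <= (G k j w ^+ 4)%:E)%E by rewrite lee_fin exprn_even_ge0.
under eq_integral => w _.
  rewrite /quartic EFinM -sumEFin.
  under eq_bigr do rewrite mxE.
  over.
rewrite ge0_integralZl//; last 2 first.
- exact: emeasurable_sum.
- by move=> w _; exact: sume_ge0.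
rewrite ge0_integral_sum//.
have int4 k : (\int[P]_w (G k j w ^+ 4)%:E <= (32 / m%:R ^+ 2)%:E)%E.
  (* The existence of [k] excludes [m = 0], for which the scale would be 0. *)
  have m0 : (0 < m)%N by exact: leq_ltn_trans (ltn_ord k).
  have s0 : 0 < (Num.sqrt m%:R)^-1 :> R by rewrite invr_gt0 sqrtr_gt0 ltr0n.
  have mx4 : measurable_fun [set: R] (fun x : R => (x ^+ 4)%:E).
    by apply/measurable_EFinP; exact: exprn_measurable.
  (* [normal_prob] lives on [measurableTypeR R], which has the same measurable
     sets as [R] but another display: repackage [G k j] accordingly. *)
  pose X : T -> measurableTypeR R := G k j.
  have mX : measurable_fun [set: T] X by exact: (measurable_funPT (G k j)).
  pose X' : {mfun T >-> measurableTypeR R} :=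
    HB.pack X (isMeasurableFun.Build _ _ _ _ X mX).
  have := @ge0_integral_distribution _ _ _ (measurableTypeR R) _ P X' _ mx4.
  rewrite /comp/= => <-; last by move=> x; rewrite lee_fin exprn_even_ge0.
  rewrite (eq_measure_integral (normal_prob 0 (Num.sqrt m%:R)^-1)); last first.
    by move=> U mU _; exact: (lawG k j).
  apply: (le_trans (normal_prob_fourth_moment_le s0)).
  by rewrite exprVn (exprM _ 2 2) sqr_sqrtr.
apply: (@le_trans _ _ (m%:R%:E * \sum_(k < m) (32 / m%:R ^+ 2)%:E)%E).
  by apply: lee_wpmul2l; [rewrite lee_fin|apply: lee_sum => k _; exact: int4].
rewrite sumEFin -EFinM lee_fin sumr_const card_ord -[X in _ * X <= _]mulr_natl.
case: (posnP m) => [->|m0]; first by rewrite mul0r.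
have m0' : m%:R != 0 :> R by rewrite pnatr_eq0 -lt0n.
by rewrite le_eqVlt; apply/orP; left; apply/eqP; field.
Qed.

Let imb w : R := imbalance R (fun j => cell q (column G w j)).

Let measurable_imb : measurable_fun [set: T] imb.
Proof.
apply: (@measurable_imbalance _ _ R _ _ (fun j w => cell q (column G w j))) => j c.
exact: measurable_column_cell.
Qed.

Let integral_imb_le : (\int[P]_w (imb w)%:E <= (2 * n%:R)%:E)%E.
Proof.
have [rho [rho0 coll]] := column_cell_collision q gaussG.
apply: (integral_imbalance_le (f := fun j w => cell q (column G w j)) rho0) => //.
by move=> j c; exact: measurable_column_cell.
Qed.

Let K : R := ((2 ^ (2 * q ^ 2).+1) ^ m)%:R.

Lemma measurable_fun_cost_bound :
  measurable_fun [set: T] (fun w => cost_bound q (column G w)).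
Proof.
apply: measurable_funD; first apply: measurable_funD => //.
  by apply: measurable_funM => //; exact: measurable_imb.
apply: measurable_funM => //; apply: measurable_funM => //.
by apply: measurable_funD => //; exact: measurable_sum.
Qed.

(** The constant is [262 = 2 + 4 + 4 * 2 * 32]: the imbalance, the constant part of the error inside
    cells, and the [2n] expected quartic terms of at most 32 each. *)
Lemma integral_cost_bound_le :
  (\int[P]_w (cost_bound q (column G w))%:E <=
   (262 * n%:R / q%:R + q%:R ^+ 3 * K)%:E)%E.
Proof.
have q0 : 0 < q%:R :> R by rewrite ltr0n.
have iq0 : 0 <= q%:R^-1 :> R by rewrite invr_ge0 ltW.
have c0 : 0 <= q%:R ^+ 3 * K + 4 * n%:R / q%:R.
  by rewrite addr_ge0 ?mulr_ge0 ?exprn_ge0// ltW.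
have intc (c : R) : (\int[P]_w c%:E = c%:E)%E.
  transitivity (c%:E * P setT)%E; first exact: (integral_cst P measurableT c%:E).
  by rewrite probability_setT mule1.
have imb0 w : 0 <= imb w by rewrite sumr_ge0// => c _; rewrite sqr_ge0.
have -> : (\int[P]_w (cost_bound q (column G w))%:E =
    \int[P]_w ((q%:R^-1)%:E * (imb w)%:E +
      ((q%:R ^+ 3 * K + 4 * n%:R / q%:R)%:E +
       (4 / q%:R)%:E * \sum_j (quartic (column G w j))%:E)))%E.
  apply: eq_integral => w _; rewrite sumEFin -!EFinM -!EFinD; congr EFin.
  by rewrite /cost_bound -/K -[imbalance _ _]/(imb w); ring.
have mq : measurable_fun [set: T] (fun w => \sum_j (quartic (column G w j))%:E)%E.
  by apply: emeasurable_sum => j; apply/measurable_EFinP.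
have q0' w : (0 <= \sum_j (quartic (column G w j))%:E)%E.
  by apply: sume_ge0 => j _; rewrite lee_fin quartic_ge0.
have c4 : (0 <= (4 / q%:R)%:E :> \bar R)%E by rewrite lee_fin divr_ge0// ltW.
rewrite ge0_integralD//; last 4 first.
- by move=> w _; rewrite -EFinM lee_fin mulr_ge0.
- by apply: measurable_funeM; exact/measurable_EFinP.
- by move=> w _; rewrite adde_ge0 ?mule_ge0.
- by apply: emeasurable_funD => //; exact: measurable_funeM.
rewrite ge0_integralZl//; last 2 first.
- exact/measurable_EFinP.
- by move=> w _; rewrite lee_fin.
rewrite ge0_integralD//; last 2 first.
- by move=> w _; rewrite mule_ge0.
- exact: measurable_funeM.
rewrite intc ge0_integralZl// ge0_integral_sum//; last 2 first.
- by move=> j; exact/measurable_EFinP.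
- by move=> j w _; rewrite lee_fin quartic_ge0.
apply: (@le_trans _ _ ((q%:R^-1)%:E * (2 * n%:R)%:E +
      ((q%:R ^+ 3 * K + 4 * n%:R / q%:R)%:E +
       (4 / q%:R)%:E * \sum_(j < n + n) 32%:E))%E).
  apply: leeD; first by apply: lee_wpmul2l; rewrite ?lee_fin.
  rewrite leeD2l//; apply: lee_wpmul2l => //; apply: lee_sum => j _.
  exact: integral_quartic_le.
rewrite sumEFin -!EFinM -!EFinD lee_fin sumr_const card_ord -[32 *+ _]mulr_natl natrD.
by lra.
Qed.

Lemma projected_cost_le (A B : 'I_n -> 'cV[R]_(n + n)) (t : R) :
  (forall k, A k = delta_mx (lshift n k) 0) ->
  (forall k, B k = delta_mx (rshift n k) 0) ->
  0 < t -> 3 * (262 * n%:R / q%:R + q%:R ^+ 3 * K) <= t ->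
  ((2 / 3)%:E <= P [set w |
     (min_matching_cost (project G A w) (project G B w) <= t)%R])%E.
Proof.
move=> Adef Bdef t0 bt.
have projE w : min_matching_cost (project G A w) (project G B w) =
    min_matching_cost (column G w \o lshift n) (column G w \o @rshift n n).
  congr min_matching_cost; apply/funext => k; apply/matrixP => i j.
    by rewrite /project Adef -colE !mxE.
  by rewrite /project Bdef -colE !mxE.
have bound0 w : 0 <= cost_bound q (column G w).
  rewrite !addr_ge0 ?mulr_ge0 ?invr_ge0 ?exprn_ge0// ?addr_ge0 ?sumr_ge0// => [c _|j _].
    by rewrite sqr_ge0.
  exact: quartic_ge0.
apply: (le_trans (markov_two_thirds measurable_fun_cost_bound bound0
  integral_cost_bound_le t0 bt)).
apply: le_measure; rewrite ?inE.
- exact/measurable_sublevel/measurable_fun_cost_bound.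
- exact: measurable_projected_cost_sublevel.
- by move=> w /=; rewrite projE; apply: le_trans; exact: min_matching_cost_le.
Qed.

End projected_cost.

(** * Asymptotics in [n] *)

Lemma near_pow_le (R : realType) (m : nat -> nat) (c K : nat) :
  (fun n : nat => (m n)%:R : R) =o_\oo (fun n : nat => ln (n%:R : R)) ->
  (0 < K)%N -> \forall n \near \oo, (c * K ^ m n <= n)%N.
Proof.
move=> mo K0.
have lnK0 : 0 <= ln (K%:R : R) by rewrite ln_ge0// ler1n.
(* With this [e] one gets [2 * m n * ln K <= ln n], that is [K ^ (2 * m n) <= n]. Together with
   [c ^ 2 <= n] this is the square of the claim. The [+ 1] keeps the denominator positive when
   [K = 1]. *)
pose e : R := (2 * (ln (K%:R : R) + 1))^-1.
have e0 : 0 < e by rewrite invr_gt0 mulr_gt0// ltr_wpDl.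
move/eqoP: mo => /(_ e e0) mo.
near=> n.
have n0 : (0 < n)%N by near: n; exact: nbhs_infty_gt.
have cn : (c ^ 2 <= n)%N by near: n; exact: nbhs_infty_ge.
have : `|(m n)%:R| <= e * `|ln (n%:R : R)| by near: n; exact: mo.
have lnn0 : 0 <= ln (n%:R : R) by rewrite ln_ge0// ler1n.
rewrite !ger0_norm// /e mulrC ler_pdivlMr ?mulr_gt0 ?ltr_wpDl// => mn.
have Kn : (K ^ (2 * m n) <= n)%N.
  rewrite -(ler_nat R) -ler_ln ?posrE ?ltr0n ?expn_gt0 ?K0// natrX lnXn ?ltr0n//.
  rewrite -[leLHS]mulr_natr natrM; apply: le_trans mn.
  have := ler0n R (m n); have := mulr_ge0 (ler0n R (m n)) lnK0; lra.
rewrite -leq_sqr expnMn -expnM [(m n * 2)%N]mulnC -[leqRHS]mulnn.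
exact: leq_mul.
Unshelve. all: by end_near. Qed.

(** Each matched pair differs by 1 in the coordinate [lshift n k]; keeping this coordinate alone
    already gives distance at least 1. *)
Lemma min_matching_cost_delta_ge (R : realType) (n : nat) :
  n%:R <= min_matching_cost
    (fun k : 'I_n => delta_mx (lshift n k) ord0 : 'cV[R]_(n + n))
    (fun k : 'I_n => delta_mx (rshift n k) ord0).
Proof.
have cost_ge s : n%:R <= matching_cost
    (fun k : 'I_n => delta_mx (lshift n k) ord0 : 'cV[R]_(n + n))
    (fun k : 'I_n => delta_mx (rshift n k) ord0) s.
  rewrite -[X in X%:R <= _]card_ord -sumr_const; apply: ler_sum => k _.
  rewrite /norm2 -[leLHS]sqrtr1 ler_wsqrtr// (bigD1 (lshift n k))//=.
  rewrite !mxE !eqxx eq_lrshift/= subr0 expr1n lerDl.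
  by apply: sumr_ge0 => i _; exact: sqr_ge0.
by apply/bigmin_geP; split.
Qed.

Theorem theorem7 (R : realType) :
  exists (d : nat -> nat) (A B : forall n : nat, 'I_n -> 'cV[R]_(d n)),
    (forall n : nat, injective (A n) /\ injective (B n)) /\
    (forall n : nat, (0 < n)%N -> 0 < min_matching_cost (A n) (B n)) /\
    forall m : nat -> nat,
      (fun n : nat => (m n)%:R : R) =o_\oo (fun n : nat => ln (n%:R : R)) ->
      exists f : nat -> R,
        f =o_\oo (fun n : nat => min_matching_cost (A n) (B n)) /\
        \forall n \near \oo,
          forall (dT : measure_display) (T : measurableType dT)
            (P : probability T R) (G : 'I_(m n) -> 'I_(d n) -> {RV P >-> R}),
            scaled_gaussian_matrix G ->
            ((2 / 3)%R%:E <=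
             P [set w | (min_matching_cost (project G (A n) w)
                                           (project G (B n) w) <= f n)%R])%E.
Proof.
(* Here [x] is [n / q] and [y] the term counting cells. The 3 comes from Markov's inequality, and
   [789 = 3 * (262 + 1)]. *)
have bound_arith (x y : R) : y <= x -> 3 * (262 * x + y) <= 789 * x by lra.
have rate_arith (e x y z : R) : 0 < e -> 0 < z -> 0 <= y -> 2 * 789 / e < z ->
    2 / e <= y -> x <= 789 * y / z -> x + 1 <= e * y.
  move=> e0 z0 y0 /ltW; rewrite !ler_pdivrMr// ler_pdivlMr// => ez ye xz.
  have ezy := ler_wpM2l y0 ez.
  suff xe : x <= e * y / 2 by lra.
  by rewrite -(ler_pM2r z0); lra.
pose A n (k : 'I_n) : 'cV[R]_(n + n) := delta_mx (lshift n k) ord0.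
pose B n (k : 'I_n) : 'cV[R]_(n + n) := delta_mx (rshift n k) ord0.
have delta_inj n : injective (fun j => delta_mx j ord0 : 'cV[R]_n).
  move=> j j' /matrixP/(_ j ord0); rewrite !mxE !eqxx andbT.
  by case: eqVneq => //= _ /eqP; rewrite oner_eq0.
have M_ge n : n%:R <= min_matching_cost (A n) (B n).
  exact: min_matching_cost_delta_ge.
exists (fun n => n + n)%N, A, B; split.
  by move=> n; split => k k' /delta_inj; [exact: lshift_inj|exact: rshift_inj].
split; first by move=> n n0; apply: lt_le_trans (M_ge n); rewrite ltr0n.
move=> m mo.
pose Q n (t : R) := 0 <= t /\
  forall (dT : measure_display) (T : measurableType dT) (P : probability T R)
    (G : 'I_(m n) -> 'I_(n + n) -> {RV P >-> R}), scaled_gaussian_matrix G ->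
  ((2 / 3)%R%:E <= P [set w | (min_matching_cost (project G (A n) w)
                                 (project G (B n) w) <= t)%R])%E.
have QP q : (0 < q)%N -> \forall n \near \oo, Q n (789 * n%:R / q%:R).
  move=> q0; have q0' : 0 < q%:R :> R by rewrite ltr0n.
  have K0 : (0 < 2 ^ (2 * q ^ 2).+1)%N by rewrite expn_gt0.
  near=> n.
  have n0 : (0 < n)%N by near: n; exact: nbhs_infty_gt.
  (* The exponent 4 is the 3 of [cost_bound] plus one, so that the term counting cells is at most
     [n / q]. *)
  have Kn : (q ^ 4 * (2 ^ (2 * q ^ 2).+1) ^ m n <= n)%N.
    by near: n; exact: near_pow_le mo K0.
  have t0 : 0 < 789 * n%:R / q%:R :> R.
    by apply: divr_gt0 q0'; apply: mulr_gt0; rewrite ltr0n.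
  split; first exact: ltW.
  move=> dT T P G gaussG; apply: (projected_cost_le (q := q)) => //.
  move: Kn; rewrite -(ler_nat R) natrM natrX => Kn.
  have : q%:R ^+ 3 * ((2 ^ (2 * q ^ 2).+1) ^ m n)%:R <= n%:R / q%:R :> R.
    by rewrite ler_pdivlMr// mulrAC -exprSr.
  by rewrite -!(mulrA _ n%:R); exact: bound_arith.
(* An infimum over all admissible [t] avoids choosing [q] as a function of [n]. It need not be
   attained; adding 1 leaves room for an admissible [t] below [f n] and is negligible against
   [n]. *)
pose f n : R := inf [set t | Q n t] + 1.
have Qlb n : has_lbound [set t | Q n t] by exists 0 => t [].
exists f; split.
  apply/eqoP => e e0.
  (* This makes [789 / q] less than [e / 2]; the other half of [e * n] absorbs the [+ 1] once
     [n >= 2 / e]. *)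
  pose q := (Num.truncn (2 * 789 / e)).+1.
  have qe : 2 * 789 / e < q%:R by exact: truncnS_gt.
  near=> n.
  have Qn : Q n (789 * n%:R / q%:R) by near: n; exact: QP.
  have n1 : 2 / e <= n%:R by near: n; exact: nbhs_infty_ger.
  have inf0 : 0 <= inf [set t | Q n t].
    by apply: lb_le_inf; [exists (789 * n%:R / q%:R)|move=> t []].
  have infle := ge_inf (Qlb n) Qn.
  have M0 : 0 <= min_matching_cost (A n) (B n) by exact: le_trans (M_ge n).
  rewrite !ger0_norm ?addr_ge0//.
  apply: (@le_trans _ _ (e * n%:R)); last by rewrite ler_pM2l.
  by apply: rate_arith qe n1 infle; rewrite ?ltr0n.
near=> n.
(* The case [q = 1] serves to show that the set of admissible [t] is nonempty, so that its infimum
   can be approached. *)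
have Qn : Q n (789 * n%:R / 1%:R) by near: n; exact: QP.
have hinf : has_inf [set t | Q n t] by split => //; exists (789 * n%:R / 1%:R).
have [t [t0 Qt] tlt] := inf_adherent ltr01 hinf.
move=> dT T P G gaussG; apply: (le_trans (Qt _ _ _ _ gaussG)).
apply: le_measure; rewrite ?inE; try exact: measurable_projected_cost_sublevel.
by move=> w /= wt; exact: le_trans wt (ltW tlt).
Unshelve. all: by end_near. Qed.
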